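(* Let $n\ge1$ and let $S=\{\mathbf{x}_0,\mathbf{x}_1,\ldots,\mathbf{x}_k\}$ be a set of distinct points of the Hamming cube $\{0,1\}^n\subset\ell_1^{(n)}$, equipped with the $\ell_1$ metric. Then $S$ has generalized roundness $\mathfrak{q}(S)=1$ if and only if the vectors $\mathbf{x}_1-\mathbf{x}_0,\mathbf{x}_2-\mathbf{x}_0,\ldots,\mathbf{x}_k-\mathbf{x}_0$ are linearly dependent in $\mathbb{R}^n$. Equivalently, $S$ has strict $1$-negative type if and only if these vectors are linearly independent in $\mathbb{R}^n$.
   Context: For $p\ge0$, a metric space $(X,d)$ has $p$-negative type if for all finite $\{x_1,\ldots,x_m\}\subseteq X$ ($m\ge2$) and all reals $\eta_1,\ldots,\eta_m$ with $\sum\eta_i=0$, $\sum_{i,j}d(x_i,x_j)^p\eta_i\eta_j\le 0$; it has strict $p$-negative type if moreover this inequality is strict whenever $(\eta_1,\ldots,\eta_m)\ne 0$. $p$ is a generalized roundness exponent if for all $m$ and all $a_1,\ldots,a_m,b_1,\ldots,b_m\in X$, $\sum_{k<l}\{d(a_k,a_l)^p+d(b_k,b_l)^p\}\le\sum_{j,i}d(a_j,b_i)^p$; the generalized roundness $\mathfrak{q}(X)$ is the supremum of all generalized roundness exponents. *)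

(* Defs.v *)
From HB Require Import structures.
From mathcomp Require Import all_boot all_order all_algebra.
From mathcomp Require Import all_classical all_reals all_analysis.
Set Implicit Arguments. Unset Strict Implicit. Unset Printing Implicit Defensive.
Import Order.TTheory GRing.Theory Num.Theory.
Local Open Scope ring_scope.

Definition l1dist (R : realType) (n : nat) (x y : 'rV[R]_n) : R :=
  \sum_(j < n) `|x 0 j - y 0 j|.

Section Metric.
Variables (R : realType) (T : Type) (d : T -> T -> R).

Definition neg_type (p : R) : Prop :=
  forall (m : nat) (y : 'I_m -> T), (1 < m)%N -> injective y ->
  forall eta : 'I_m -> R, \sum_(i < m) eta i = 0 ->
    \sum_(i < m) \sum_(j < m) (d (y i) (y j)) `^ p * eta i * eta j <= 0.

Definition strict_neg_type (p : R) : Prop :=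
  neg_type p /\
  forall (m : nat) (y : 'I_m -> T), (1 < m)%N -> injective y ->
  forall eta : 'I_m -> R, \sum_(i < m) eta i = 0 -> (exists i, eta i != 0) ->
    \sum_(i < m) \sum_(j < m) (d (y i) (y j)) `^ p * eta i * eta j < 0.

Definition gr_exponent (p : R) : Prop :=
  forall (m : nat) (a b : 'I_m -> T),
    \sum_(k < m) \sum_(l < m | (k < l)%N)
        ((d (a k) (a l)) `^ p + (d (b k) (b l)) `^ p)
    <= \sum_(j < m) \sum_(i < m) (d (a j) (b i)) `^ p.

Definition gen_roundness : \bar R :=
  ereal_sup [set p%:E | p in [set p : R | 0 <= p /\ gr_exponent p]].

End Metric.

(* Main.v *)
(** On the cube the l1 metric is a squared Euclidean distance, so for weights [eta] of sum zero
    the form [sum d(x_i, x_j) eta_i eta_j] equals [-2 |sum eta_i x_i|^2]. It is always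
    nonpositive, and it is definite exactly when the points are affinely independent. A
    generalized roundness exponent [p] is an exponent for which [d^p] has negative type: the
    multiplicities of a pair of families (a, b) realize all integral weights of sum zero.
    If the points are independent, the form at [p = 1] is uniformly negative, and by continuity
    in [p] some [p > 1] is still an exponent. If they are dependent and [p > 1] were an exponent,
    a strict form of Schoenberg's theorem applied to [d = (d^p)^(1/p)] would make the form at
    [p = 1] definite. *)
Require Import Defs.
From HB Require Import structures.
From mathcomp Require Import all_boot all_order all_algebra.
From mathcomp Require Import all_classical all_reals all_analysis.
From mathcomp Require Import ring lra.
Import Order.TTheory GRing.Theory Num.Theory.
Import numFieldNormedType.Exports.
Local Open Scope ring_scope.
Set Implicit Arguments. Unset Strict Implicit. Unset Printing Implicit Defensive.

(** * Quadratic forms, positive semidefinite kernels and their exponentials *)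

Definition qform (R : numDomainType) (T : finType) (K : T -> T -> R) (u : T -> R) : R :=
  \sum_i \sum_j K i j * u i * u j.

Definition psd_kernel (R : numDomainType) (T : finType) (K : T -> T -> R) : Prop :=
  forall u, 0 <= qform K u.

Definition neg_kernel (R : numDomainType) (T : finType) (D : T -> T -> R) : Prop :=
  forall u, \sum_i u i = 0 -> qform D u <= 0.

Section Psd.
Variable R : realType.

Lemma qform_rank_one (T : finType) (v u : T -> R) :
  qform (fun i j => v i * v j) u = (\sum_i v i * u i) ^+ 2.
Proof.
rewrite expr2 mulr_suml; apply: eq_bigr => i _; rewrite mulr_sumr.
by apply: eq_bigr => j _; ring.
Qed.

Lemma qform_sum (T : finType) (I : Type) (s : seq I) (K : I -> T -> T -> R) u :
  qform (fun i j => \sum_(a <- s) K a i j) u = \sum_(a <- s) qform (K a) u.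
Proof.
rewrite /qform [RHS]exchange_big; apply: eq_bigr => i _.
rewrite [RHS]exchange_big; apply: eq_bigr => j _.
by rewrite !mulr_suml.
Qed.

Lemma eq_qform (T : finType) (K L : T -> T -> R) u :
  (forall i j, K i j = L i j) -> qform K u = qform L u.
Proof. by move=> e; apply: eq_bigr => i _; apply: eq_bigr => j _; rewrite e. Qed.

Lemma cvg_qform (T : finType) (K : nat -> T -> T -> R) (u : nat -> T -> R)
    (K' : T -> T -> R) (u' : T -> R) :
  (forall i j, K N i j @[N --> \oo] --> K' i j)%classic ->
  (forall i, u N i @[N --> \oo] --> u' i)%classic ->
  (qform (K N) (u N) @[N --> \oo] --> qform K' u')%classic.
Proof.
move=> cK cu; rewrite /qform.
apply: cvg_big => [|i _]; first exact: add_continuous.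
apply: cvg_big => [|j _]; first exact: add_continuous.
by apply: cvgM; [apply: cvgM; [exact: cK|exact: cu]|exact: cu].
Qed.

(* Cholesky: subtracting the rank-one kernel built from the first row leaves a
   positive semidefinite kernel supported away from the first index. *)
Lemma psd_gram n (K : 'I_n -> 'I_n -> R) :
  (forall i j, K i j = K j i) -> psd_kernel K ->
  exists s : seq ('I_n -> R), forall i j, K i j = \sum_(v <- s) v i * v j.
Proof.
elim: n K => [|n IH] K symK psdK; first by exists [::] => -[].
pose ext (t : R) (w : 'I_n -> R) i := if unlift ord0 i is Some j then w j else t.
pose b (w : 'I_n -> R) := \sum_j K ord0 (lift ord0 j) * w j.
pose K1 i j := K (lift ord0 i) (lift ord0 j).
have extE t w : qform K (ext t w) = K ord0 ord0 * t ^+ 2 + b w * t *+ 2 + qform K1 w.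
  have e0 : ext t w ord0 = t by rewrite /ext unlift_none.
  have e1 j : ext t w (lift ord0 j) = w j by rewrite /ext liftK.
  rewrite /qform big_ord_recl big_ord_recl e0.
  have -> : \sum_(i < n) K ord0 (lift ord0 i) * t * ext t w (lift ord0 i) = b w * t.
    by rewrite /b mulr_suml; apply: eq_bigr => j _; rewrite e1 mulrAC.
  have -> : \sum_(i < n) \sum_(j < n.+1) K (lift ord0 i) j * ext t w (lift ord0 i) * ext t w j
     = b w * t + qform K1 w.
    rewrite /b mulr_suml -big_split; apply: eq_bigr => i _ /=.
    rewrite big_ord_recl e0 e1 symK; congr (_ + _).
    by apply: eq_bigr => j _; rewrite e1.
  by rewrite addrA; congr (_ + _); ring.
set a := K ord0 ord0 in extE.
have a0 : 0 <= a.
  have := psdK (ext 1 (fun=> 0)); rewrite extE.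
  have -> : b (fun=> 0) = 0 by rewrite /b big1 // => j _; rewrite mulr0.
  have -> : qform K1 (fun=> 0) = 0.
    by rewrite /qform big1 // => i _; rewrite big1 // => j _; rewrite mulr0.
  by lra.
(* If [a = 0], the form is affine in [t]; a nonzero entry of the first row gives a nonzero slope,
   and a suitable [t] brings the value to -1. *)
have row0 : a = 0 -> forall j, K ord0 j = 0.
  move=> az j; case: (unliftP ord0 j) => [j' ->|->]; last exact: az.
  pose dl (i : 'I_n) : R := (i == j')%:R.
  have bE : b dl = K ord0 (lift ord0 j').
    rewrite /b (bigD1 j') //= big1 /dl ?eqxx ?mulr1 ?addr0// => i /negbTE ->.
    by rewrite mulr0.
  apply/eqP; apply: contraT => nz.
  have := psdK (ext (- (qform K1 dl + 1) / (K ord0 (lift ord0 j')) / 2) dl).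
  rewrite extE az bE; set q := qform _ _; set c := K _ _ in nz *.
  suff -> : 0 * (- (q + 1) / c / 2) ^+ 2 + c * (- (q + 1) / c / 2) *+ 2 + q = -1 by lra.
  by field.
(* For [a = 0] division by zero makes [r] vanish, which agrees with [row0]; the two cases therefore
   share one formula. *)
pose r i := K ord0 i / Num.sqrt a.
have rE i j : r i * r j = K ord0 i * K ord0 j / a.
  by rewrite /r mulrACA -invfM -expr2 sqr_sqrtr.
pose K2 i j := K1 i j - r (lift ord0 i) * r (lift ord0 j).
have [|w|s sE] := IH K2.
- by move=> i j; rewrite /K2 /K1 symK [r _ * _]mulrC.
(* For [a != 0] this first coordinate minimizes the quadratic polynomial in [t]; the minimum is
   exactly the form of [K2] at [w]. *)
- have := psdK (ext (- b w / a) w); rewrite extE.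
  have -> : qform K2 w = qform K1 w - b w ^+ 2 / a.
    have -> : b w ^+ 2 / a = (\sum_i r (lift ord0 i) * w i) ^+ 2.
      rewrite -[in LHS](sqr_sqrtr a0) -exprVn -exprMn /b mulr_suml.
      by congr (_ ^+ 2); apply: eq_bigr => i _; rewrite /r mulrAC.
    rewrite -qform_rank_one /qform -sumrB; apply: eq_bigr => i _.
    by rewrite -sumrB; apply: eq_bigr => j _; rewrite /K2; ring.
  have [az|anz] := eqVneq a 0; first by rewrite az invr0; lra.
  suff -> : a * (- b w / a) ^+ 2 + b w * (- b w / a) *+ 2 = - (b w ^+ 2 / a) by lra.
  by field.
exists (r :: map (ext 0) s) => i j; rewrite big_cons big_map.
have col0 i' : r ord0 * r i' = K ord0 i'.
  rewrite rE; have [az|anz] := eqVneq a 0; last by rewrite mulrAC divff ?mul1r.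
  by rewrite !row0 ?mul0r.
case: (unliftP ord0 i) => [i' ->|->]; last first.
  by rewrite col0 big1 ?addr0 // => v _; rewrite {1}/ext unlift_none mul0r.
case: (unliftP ord0 j) => [j' ->|->]; last first.
  rewrite mulrC col0 symK big1 ?addr0 // => v _.
  by rewrite {2}/ext unlift_none mulr0.
rewrite -[LHS](subrK (r (lift ord0 i') * r (lift ord0 j'))) addrC -/(K1 i' j') -/(K2 i' j') sE.
by congr (_ + _); apply: eq_bigr => v _; rewrite /ext !liftK.
Qed.

Lemma gram_psd (T : finType) (s : seq (T -> R)) :
  psd_kernel (fun i j => \sum_(v <- s) v i * v j).
Proof.
by move=> u; rewrite qform_sum; apply: sumr_ge0 => v _; rewrite qform_rank_one sqr_ge0.
Qed.

(** Schur product argument: the entrywise product of two Gram kernels is the Gram kernel of all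
    pairwise products of their vectors. *)
Lemma psd_expn n (K : 'I_n -> 'I_n -> R) m :
  (forall i j, K i j = K j i) -> psd_kernel K -> psd_kernel (fun i j => K i j ^+ m).
Proof.
move=> symK psdK; have [s sE] := psd_gram symK psdK.
suff [t tE] : exists t : seq ('I_n -> R), forall i j, K i j ^+ m = \sum_(v <- t) v i * v j.
  by move=> u; rewrite (eq_qform u tE); apply: gram_psd.
elim: m => [|m [t tE]]; first by exists [:: fun=> 1] => i j; rewrite big_seq1 mulr1.
exists [seq (fun i => v i * w i) | v <- s, w <- t] => i j.
rewrite exprS tE sE big_allpairs_dep mulr_suml; apply: eq_bigr => v _.
by rewrite mulr_sumr; apply: eq_bigr => w _; rewrite mulrACA.
Qed.

(** The partial sums of the exponential series are nonnegative combinations of entrywise powers, and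
    nonnegativity of the form passes to the limit. *)
Lemma psd_expR n (K : 'I_n -> 'I_n -> R) :
  (forall i j, K i j = K j i) -> psd_kernel K -> psd_kernel (fun i j => expR (K i j)).
Proof.
move=> symK psdK u.
pose S N := qform (fun i j => \sum_(0 <= m < N) exp_coeff (K i j) m) u.
have S0 N : 0 <= S N.
  rewrite /S qform_sum; apply: sumr_ge0 => m _.
  have -> : qform (fun i j => exp_coeff (K i j) m) u
      = qform (fun i j => K i j ^+ m) u / m`!%:R.
    rewrite /qform mulr_suml; apply: eq_bigr => i _; rewrite mulr_suml.
    by apply: eq_bigr => j _; rewrite /exp_coeff /=; ring.
  by rewrite divr_ge0 // psd_expn.
have Scvg : (S N @[N --> \oo] --> qform (fun i j => expR (K i j)) u)%classic.
  apply: (cvg_qform (u := fun=> u)) => [i j|i]; last exact: cvg_cst.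
  exact: is_cvg_series_exp_coeff.
rewrite -(cvg_lim _ Scvg) //; apply: limr_ge; first by apply/cvg_ex; eexists; exact: Scvg.
by near=> N; apply: S0.
Unshelve. all: by end_near.
Qed.

(* Based at the index [ord0], [K i j = D i 0 + D 0 j - D i j] is positive semidefinite, and
   [exp (- s D)] is [exp (s K)] up to a positive diagonal scaling. *)
Lemma neg_kernel_expR n (D : 'I_n.+1 -> 'I_n.+1 -> R) s :
  (forall i j, D i j = D j i) -> D ord0 ord0 = 0 -> neg_kernel D -> 0 <= s ->
  psd_kernel (fun i j => expR (- s * D i j)).
Proof.
move=> symD D0 negD s0 u.
pose K i j := s * (D i ord0 + D j ord0 - D i j).
have psdK : psd_kernel K.
  (* Subtracting the total mass of [w] at the base index gives [w'] of sum zero, and the form of [K]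
     at [w] is [- s] times the form of [D] at [w']. *)
  move=> w; pose t := \sum_i w i.
  pose w' i := w i - t * (i == ord0)%:R.
  have sd (f : 'I_n.+1 -> R) : \sum_i f i * (i == ord0)%:R = f ord0.
    rewrite (bigD1 ord0) //= mulr1 big1 ?addr0 // => i /negbTE ->.
    by rewrite mulr0.
  have /negD : \sum_i w' i = 0.
    rewrite sumrB -mulr_sumr.
    have -> : \sum_(i < n.+1) (i == ord0)%:R = 1 :> R.
      by rewrite -[RHS](sd (fun=> 1)); apply: eq_bigr => i _; rewrite mul1r.
    by rewrite mulr1 subrr.
  pose c := \sum_i D i ord0 * w i.
  have -> : qform D w' = qform D w - t * c *+ 2.
    have inner i : \sum_j D i j * w' i * w' j = (\sum_j D i j * w j) * w' i - D i ord0 * w' i * t.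
      transitivity (\sum_j (D i j * w j * w' i - (D i j * w' i * t) * (j == ord0)%:R)).
        by apply: eq_bigr => j _; rewrite /w'; ring.
      by rewrite sumrB sd mulr_suml.
    rewrite /qform; under eq_bigr do rewrite inner.
    transitivity (\sum_i (\sum_j D i j * w i * w j - D i ord0 * w i * t -
        (((\sum_j D i j * w j) - D i ord0 * t) * t) * (i == ord0)%:R)).
      apply: eq_bigr => i _.
      have -> : \sum_j D i j * w i * w j = (\sum_j D i j * w j) * w i.
        by rewrite mulr_suml; apply: eq_bigr => j _; rewrite mulrAC.
      by rewrite /w'; ring.
    rewrite sumrB sd sumrB -mulr_suml -/c D0.
    have -> : \sum_j D ord0 j * w j = c by apply: eq_bigr => j _; rewrite symD.
    by ring.
  have -> : qform K w = s * (t * c *+ 2 - qform D w).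
    have -> : t * c *+ 2 = \sum_i \sum_j (D i ord0 + D j ord0) * w i * w j.
      have -> : t * c *+ 2 = c * t + t * c by ring.
      rewrite /c /t 2!mulr_suml -big_split; apply: eq_bigr => i _ /=.
      by rewrite 2!mulr_sumr -big_split; apply: eq_bigr => j _ /=; ring.
    rewrite /qform -sumrB mulr_sumr; apply: eq_bigr => i _.
    by rewrite -sumrB mulr_sumr; apply: eq_bigr => j _; rewrite /K; ring.
  by move=> h; apply: mulr_ge0 => //; lra.
have symK i j : K i j = K j i by rewrite /K (symD i j) [D i ord0 + _]addrC.
have := psd_expR symK psdK (fun i => expR (- s * D i ord0) * u i).
congr (_ <= _); apply: eq_bigr => i _; apply: eq_bigr => j _.
have -> : - s * D i j = K i j + (- s * D i ord0) + (- s * D j ord0) by rewrite /K; ring.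
by rewrite !expRD; ring.
Qed.

End Psd.

(* Coefficients of the binomial series: (1 - z)^a = 1 - sum_k binom_coef a k * z^(k+1). *)
Fixpoint binom_coef (R : realType) (a : R) (k : nat) : R :=
  if k is k'.+1 then binom_coef a k' * (k%:R - a) / k.+1%:R else a.

Definition binom_sum (R : realType) (a : R) (N : nat) (z : R) : R :=
  1 - \sum_(k < N) binom_coef a k * z ^+ k.+1.

(** * Convergence of the binomial series of [(1 - z) ^ a] for [0 <= z < 1] *)

Section Binomial.
Variables (R : realType) (a : R).
Hypotheses (a0 : 0 < a) (a1 : a < 1).

Lemma binom_coef_ge0 k : 0 <= binom_coef a k.
Proof.
elim: k => [|k IH] /=; first exact: ltW.
apply: divr_ge0 => //; apply: mulr_ge0 => //.
by rewrite subr_ge0 (le_trans (ltW a1)) // ler1n.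
Qed.

(** The product [k.+1 * binom_coef a k] starts at [a] and drops by [a * binom_coef a k] at each
    step. *)
Lemma binom_coef_le k : k.+1%:R * binom_coef a k <= a.
Proof.
elim: k => [|k IH] /=; first by rewrite mul1r.
have -> : k.+2%:R * (binom_coef a k * (k.+1%:R - a) / k.+2%:R)
    = k.+1%:R * binom_coef a k - a * binom_coef a k.
  by field; rewrite -natr1 -natr1; have := ler0n R k; lra.
by have := mulr_ge0 (ltW a0) (binom_coef_ge0 k); lra.
Qed.

(** This closed form gives the sign of the partial sums at 1, which is what controls the constant
    term [w0] in [exp_sum_power_le0]. *)
Lemma binom_sum1 N : binom_sum a N 1 = N.+1%:R * binom_coef a N / a.
Proof.
have an0 : a != 0 by rewrite gt_eqF.
rewrite /binom_sum; elim: N => [|N IH]; first by rewrite big_ord0 subr0 mul1r divff.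
rewrite big_ord_recr /= opprD addrA IH expr1n mulr1 -[N.+2%:R]natr1.
have : 0 < N.+1%:R :> R by rewrite ltr0n.
by move: N.+1%:R (binom_coef a N) => m c m0; field; rewrite an0 /=; lra.
Qed.

Lemma binom_sum1_ge0 N : 0 <= binom_sum a N 1.
Proof.
rewrite binom_sum1; apply: divr_ge0; last exact: ltW.
by rewrite mulr_ge0 ?binom_coef_ge0.
Qed.

Definition binom_deriv N (z : R) := - \sum_(k < N) k.+1%:R * binom_coef a k * z ^+ k.

Lemma is_derive_binom_sum N (z : R) :
  is_derive z 1 (binom_sum a N) (binom_deriv N z).
Proof.
elim: N => [|N IH].
  have -> : binom_sum a 0 = cst 1 by apply/funext => y; rewrite /binom_sum big_ord0 subr0.
  by rewrite /binom_deriv big_ord0 oppr0; exact: is_derive_cst.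
have -> : binom_sum a N.+1 = binom_sum a N - (binom_coef a N \*: (fun y : R => y ^+ N.+1)).
  by apply/funext => y; rewrite /binom_sum !fctE big_ord_recr /= opprD addrA.
rewrite /binom_deriv big_ord_recr /= opprD.
have -> : N.+1%:R * binom_coef a N * z ^+ N = binom_coef a N *: (N.+1%:R * z ^+ N *: 1).
  by rewrite /GRing.scale /=; ring.
apply: is_deriveB; apply: is_deriveZ.
have := is_deriveX N.+1 (is_derive_id z 1).
by congr is_derive; apply/funext => y; rewrite exprfctE.
Qed.

(* [(1 - z) f' + a f = 0] is the differential equation of [(1 - z)^a]. *)
Lemma binom_sum_ode N z :
  (1 - z) * binom_deriv N.+1 z + a * binom_sum a N.+1 z =
    (N.+1%:R - a) * binom_coef a N * z ^+ N.+1.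
Proof.
rewrite /binom_sum /binom_deriv; elim: N => [|N IH].
  by rewrite !big_ord_recr !big_ord0 /= expr0 expr1; ring.
rewrite big_ord_recr [in a * _]big_ord_recr /=.
set S1 := \sum_(i < _) _ in IH *; set S2 := \sum_(i < _) _ in IH *.
have e : binom_coef a N * (N.+1%:R - a) / N.+2%:R * N.+2%:R = binom_coef a N * (N.+1%:R - a).
  by rewrite divfK // pnatr_eq0.
set c := _ / N.+2%:R in e *.
rewrite [z ^+ N.+2]exprS; move: IH e; move: (z ^+ N.+1) => y IH e.
transitivity ((1 - z) * - S1 + a * (1 - S2) - (1 - z) * (c * N.+2%:R) * y - a * c * (z * y)).
  by ring.
rewrite IH e; transitivity ((N.+2%:R * c - a * c) * (z * y)); last by ring.
by rewrite [_ * c]mulrC e; ring.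
Qed.

(** The quotient of the partial sum by [(1 - z) ^ a] equals 1 at 0, and the differential equation
    reduces its derivative to a single term; the mean value theorem then bounds the error. *)
Lemma binom_sum_bound N z : 0 <= z -> z < 1 ->
  `|binom_sum a N.+1 z - (1 - z) `^ a| <= a / (1 - z) `^ (a + 1) * z ^+ N.
Proof.
move=> z0 z1.
pose f y := binom_sum a N.+1 y * (1 - y) `^ (- a).
pose df y := (N.+1%:R - a) * binom_coef a N * y ^+ N.+1 * (1 - y) `^ (- a - 1).
have fder (y : R) : y < 1 -> is_derive y 1 f (df y).
  move=> y1; have y1' : 0 < 1 - y by lra.
  have d1 := is_derive_binom_sum N.+1 y.
  have d2 : is_derive y 1 (fun y : R => 1 - y) (-1).
    have -> : (-1 : R) = 0 - 1 by rewrite sub0r.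
    exact: is_deriveB.
  have d3 := is_derive1_powR (- a) y1'.
  have d4 : is_derive y 1 ((powR (R:=R))^~ (- a) \o (fun y : R => 1 - y))
      (-1 *: (- a * (1 - y) `^ (- a - 1))).
    have := @is_derive1_comp _ ((powR (R:=R))^~ (- a)) (fun y : R => 1 - y) y _ _ d3 d2.
    by rewrite /GRing.scale /= mulrC.
  have d5 := is_deriveM d1 d4.
  suff -> : df y = binom_sum a N.+1 y *: (-1 *: (- a * (1 - y) `^ (- a - 1)))
      + (1 - y) `^ (- a) *: binom_deriv N.+1 y by [].
  rewrite /df -binom_sum_ode /GRing.scale /=.
  have -> : (1 - y) `^ (- a) = (1 - y) * (1 - y) `^ (- a - 1).
    rewrite -{2}(powRr1 (ltW y1')) -powRD; first by congr (_ `^ _); ring.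
    by rewrite (gt_eqF y1') implybT.
  by ring.
have fcont : {within `[0, z], continuous f}%classic.
  apply: derivable_within_continuous => y; rewrite in_itv /= => /andP[_ yz].
  by have := fder y (le_lt_trans yz z1) => -[].
have [|c czI e] := MVT_segment z0 _ fcont (df := df).
  by move=> y; rewrite in_itv /= => /andP[_ yz]; apply: fder; lra.
move: czI; rewrite in_itv /= => /andP[c0 cz].
have z1' : 0 < 1 - z by lra.
have f0 : f 0 = 1.
  rewrite /f subr0 powR1 mulr1 /binom_sum big1 ?subr0 // => i _.
  by rewrite expr0n mulr0.
have P0 : 0 < (1 - z) `^ a by rewrite powR_gt0.
have -> : binom_sum a N.+1 z - (1 - z) `^ a = (1 - z) `^ a * z * df c.
  move: e; rewrite f0 subr0 /f powRN -mulrA [z * _]mulrC => <-.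
  by rewrite mulrBr mulr1 mulrCA divff ?mulr1 ?gt_eqF.
have df0 : 0 <= df c.
  rewrite /df !mulr_ge0 ?powR_ge0 ?exprn_ge0 ?binom_coef_ge0 //.
  by rewrite subr_ge0 (le_trans (ltW a1)) // ler1n.
(* The coefficient is at most [a] by [binom_coef_le], [c ^ N.+1 <= z ^ N] because [c <= z <= 1], and
   the negative power of [1 - c] is largest at [c = z]. *)
have dfle : df c <= a * z ^+ N / (1 - z) `^ (a + 1).
  rewrite /df; have -> : - a - 1 = - (a + 1) by ring.
  rewrite powRN; apply: ler_pM.
  - rewrite !mulr_ge0 ?exprn_ge0 ?binom_coef_ge0 //.
    by rewrite subr_ge0 (le_trans (ltW a1)) // ler1n.
  - by rewrite invr_ge0 powR_ge0.
  - apply: ler_pM; rewrite ?exprn_ge0 //.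
    + rewrite mulr_ge0 ?binom_coef_ge0 //.
      by rewrite subr_ge0 (le_trans (ltW a1)) // ler1n.
    + have := binom_coef_le N; have := mulr_ge0 (ltW a0) (binom_coef_ge0 N); lra.
    + rewrite (le_trans (lerXn2r N.+1 _ _ cz)) ?nnegrE // exprS ler_piMl ?exprn_ge0 //.
      exact: ltW.
  - rewrite lef_pV2 ?posrE ?powR_gt0 //; [|lra].
    apply: ge0_ler_powR; [exact: addr_ge0 (ltW a0) _ | rewrite nnegrE; lra..|lra].
rewrite ger0_norm; last by apply: mulr_ge0 => //; rewrite mulr_ge0 ?powR_ge0.
have -> : a / (1 - z) `^ (a + 1) * z ^+ N = a * z ^+ N / (1 - z) `^ (a + 1) by ring.
apply: le_trans dfle; rewrite ler_piMl //.
apply: mulr_ile1; [exact: powR_ge0|exact: z0| |exact: ltW].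
suff : (1 - z) `^ a <= 1 `^ a by rewrite powR1.
by apply: ge0_ler_powR; [exact: ltW|rewrite nnegrE; lra..|lra].
Qed.

Lemma binom_sum_cvg z : 0 <= z -> z < 1 ->
  (binom_sum a N.+1 z @[N --> \oo] --> (1 - z) `^ a)%classic.
Proof.
move=> z0 z1; apply/cvgrPdist_le => e e0.
have /cvgrPdist_le/(_ e e0) : (a / (1 - z) `^ (a + 1) * z ^+ N @[N --> \oo] --> (0 : R))%classic.
  by apply: cvg_geometric; rewrite ger0_norm.
apply: filterS => N; rewrite sub0r normrN => h.
rewrite distrC (le_trans (binom_sum_bound _ z0 z1)) //.
by rewrite (le_trans _ h) // ler_norm.
Qed.

End Binomial.

(** * Strict negative type of the powers [D ^ a], [0 < a < 1], of a kernel of negative type *)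

Section Schoenberg.
Variable R : realType.

(* By the binomial series, [sum_i w i (1 - e^(- s t_i))^a] is minus a combination, with
   nonnegative coefficients, of values of the exponential sum at multiples of [s]. Divide by
   [s^a] and let [s] tend to 0. *)
Lemma exp_sum_power_le0 (I : finType) (w t : I -> R) (w0 a : R) :
  0 < a -> a < 1 -> (forall i, 0 < t i) -> 0 <= w0 -> w0 + \sum_i w i = 0 ->
  (forall u, 0 <= u -> 0 <= w0 + \sum_i w i * expR (- u * t i)) ->
  \sum_i w i * t i `^ a <= 0.
Proof.
move=> a0 a1 t0 w00 wsum wpos.
have t0' i : 0 <= t i by exact: ltW.
have a0' := ltW a0.
have zlt1 s i : 0 < s -> expR (- s * t i) < 1.
  by move=> s0; rewrite expR_lt1 mulNr oppr_lt0 mulr_gt0.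
have step1 s : 0 < s -> \sum_i w i * (1 - expR (- s * t i)) `^ a <= 0.
  move=> s0.
  have cv : (\sum_i w i * binom_sum a N.+1 (expR (- s * t i)) @[N --> \oo] -->
      \sum_i w i * (1 - expR (- s * t i)) `^ a)%classic.
    apply: cvg_big => [|i _]; first exact: add_continuous.
    by apply: cvgMl_tmp; apply: binom_sum_cvg; rewrite ?expR_ge0 ?zlt1.
  apply: (cvgr_to_le cv); apply: nearW => N.
  (* Powers of the exponentials are exponentials at time [k.+1 * s]. Adding [w0] to each inner sum,
     together with [\sum_i w i = - w0], produces the partial sum at 1. *)
  have -> : \sum_i w i * binom_sum a N.+1 (expR (- s * t i)) =
     - w0 * binom_sum a N.+1 1 - \sum_(k < N.+1) binom_coef a k *
        (w0 + \sum_i w i * expR (- (k.+1%:R * s) * t i)).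
    transitivity (\sum_i (w i - \sum_(k < N.+1) binom_coef a k *
         (w i * expR (- (k.+1%:R * s) * t i)))).
      apply: eq_bigr => i _; rewrite /binom_sum mulrBr mulr1 mulr_sumr; congr (_ - _).
      apply: eq_bigr => k _; rewrite -expRM_natl.
      have -> : k.+1%:R * (- s * t i) = - (k.+1%:R * s) * t i by ring.
      by ring.
    rewrite sumrB exchange_big /= (_ : \sum_i w i = - w0); last by lra.
    rewrite /binom_sum mulrBr mulr1 -addrA; congr (_ + _).
    rewrite mulNr opprK mulr_sumr -sumrB -sumrN; apply: eq_bigr => k _.
    by rewrite expr1n mulr1 -mulr_sumr; ring.
  rewrite mulNr subr_le0 lerNl; apply: le_trans (mulr_ge0 w00 (binom_sum1_ge0 a0 a1 _)).
  rewrite oppr_le0; apply: sumr_ge0 => k _; apply: mulr_ge0.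
    exact: binom_coef_ge0.
  by apply: wpos; rewrite mulr_ge0 ?ler0n ?ltW.
(* From [x * expR (- x) <= 1 - expR (- x) <= x] at [x = s * t i], the quotient [v i] below differs
   from [t i ^ a] by at most [t i ^ a * (a * t i) * s]. *)
pose C := \sum_i `|w i| * (t i `^ a * (a * t i)).
have step2 s : 0 < s -> \sum_i w i * t i `^ a <= C * s.
  move=> s0; have sa0 : 0 < s `^ a by rewrite powR_gt0.
  have s0' := ltW s0; have h := step1 s s0.
  pose v i := (1 - expR (- s * t i)) `^ a / s `^ a.
  have le1 i : v i <= t i `^ a.
    rewrite ler_pdivrMr // -powRM //; apply: ge0_ler_powR => //; rewrite ?nnegrE.
    - by rewrite subr_ge0 ltW // zlt1.
    - by rewrite mulr_ge0.
    - by have := expR_ge1Dx (- s * t i); lra.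
  have le2 i : t i `^ a - t i `^ a * (a * t i) * s <= v i.
    apply: (@le_trans _ _ (t i `^ a * expR (- s * t i * a))).
      rewrite -[X in X - _]mulr1 -mulrA -mulrBr ler_wpM2l ?powR_ge0 //.
      by have := expR_ge1Dx (- s * t i * a); lra.
    rewrite expRM -powRM ?expR_ge0 // ler_pdivlMr // -powRM ?mulr_ge0 ?expR_ge0 //.
    have g := expR_gt0 (- s * t i).
    apply: ge0_ler_powR; rewrite ?nnegrE ?mulr_ge0 ?subr_ge0 ?(ltW (zlt1 _ _ _)) ?(ltW g) //.
    have := expR_ge1Dx (s * t i); have e := expRxMexpNx_1 (s * t i).
    rewrite -mulNr in e.
    rewrite -(ler_pM2l g) [X in _ <= X]mulrC e; lra.
  have vs : \sum_i w i * v i <= 0.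
    have -> : \sum_i w i * v i = (\sum_i w i * (1 - expR (- s * t i)) `^ a) / s `^ a.
      by rewrite mulr_suml; apply: eq_bigr => i _; rewrite /v mulrA.
    by rewrite pmulr_lle0 ?invr_gt0.
  suff : \sum_i w i * t i `^ a - \sum_i w i * v i <= C * s by lra.
  rewrite -sumrB /C mulr_suml; apply: ler_sum => i _.
  rewrite -mulrBr (le_trans (ler_norm _)) // normrM -mulrA ler_wpM2l //.
  by rewrite ger0_norm; have := le1 i; have := le2 i; lra.
have C0 : 0 <= C.
  by apply: sumr_ge0 => i _; rewrite !mulr_ge0 ?powR_ge0 // ltW.
rewrite leNgt; apply/negP => pos; set X := \sum_i _ in step2 pos.
have c0 : 0 < C + 1 by lra.
have := step2 (X / (C + 1) / 2) _; rewrite !divr_gt0 // => /(_ isT).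
rewrite leNgt => /negP; apply.
have : C * X < (C + 1) * X by nra.
have -> : C * (X / (C + 1) / 2) = C * X / (C + 1) / 2 by ring.
rewrite ltr_pdivrMr // ltr_pdivrMr //; nra.
Qed.

Lemma qform_diag (T : finType) (K : T -> T -> R) u :
  qform K u = \sum_i K i i * u i ^+ 2 + \sum_i \sum_(j | j != i) K i j * u i * u j.
Proof.
rewrite /qform -big_split; apply: eq_bigr => i _ /=.
by rewrite (bigD1 i) //= expr2 mulrA.
Qed.

(* [h u = qform (expR (- u D)) eta] is nonnegative and tends to [|eta|^2], so it dominates
   [delta * (1 - e^(- tau u)) (1 - B e^(- tau u))], which is negative before the time [U]
   such that [e^(tau U) = B]. Compare the power functionals of both sides; [B = 2^(1-a)] makes
   that of the minorant positive. *)
Lemma neg_kernel_power_lt0 n (D : 'I_n.+1 -> 'I_n.+1 -> R) (a : R) (eta : 'I_n.+1 -> R) :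
  (forall i j, D i j = D j i) -> (forall i, D i i = 0) ->
  (forall i j, i != j -> 0 < D i j) -> neg_kernel D ->
  0 < a -> a < 1 -> \sum_i eta i = 0 -> (exists i, eta i != 0) ->
  qform (fun i j => D i j `^ a) eta < 0.
Proof.
move=> symD D0 posD negD a0 a1 sum0 [i0 nz].
pose E := \sum_i eta i ^+ 2.
have E0 : 0 < E.
  rewrite /E (bigD1 i0) //=; apply: ltr_pwDl; first by rewrite exprn_even_gt0.
  by apply: sumr_ge0 => i _; rewrite sqr_ge0.
pose delta := E / 2.
pose h u := qform (fun i j => expR (- u * D i j)) eta.
have h0 u : 0 <= u -> 0 <= h u.
  by move=> u0; apply: (neg_kernel_expR symD (D0 ord0) negD u0).
have hE u : h u = E + \sum_i \sum_(j | j != i) expR (- u * D i j) * eta i * eta j.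
  rewrite /h qform_diag; congr (_ + _); apply: eq_bigr => i _.
  by rewrite D0 mulr0 expR0 mul1r.
(* The bound [expR (- x) <= 1 / x] makes the off-diagonal part of [h u] at most [M / u] in absolute
   value. *)
pose M := \sum_i \sum_(j | j != i) `|eta i| * `|eta j| / D i j.
have M0 : 0 <= M.
  apply: sumr_ge0 => i _; apply: sumr_ge0 => j ji.
  by rewrite divr_ge0 ?mulr_ge0 // ltW // posD // eq_sym.
have hlarge u : 0 < u -> E - M / u <= h u.
  move=> u0; rewrite hE lerD2l -lerN2 opprK -sumrN /M mulr_suml; apply: ler_sum => i _.
  rewrite -sumrN mulr_suml; apply: ler_sum => j ji.
  have Dp : 0 < D i j by rewrite posD // eq_sym.
  rewrite (le_trans (ler_norm _)) // normrN !normrM ger0_norm ?expR_ge0 //.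
  have -> : `|eta i| * `|eta j| / D i j / u = (u * D i j)^-1 * `|eta i| * `|eta j|.
    by field; rewrite !gt_eqF.
  rewrite -!mulrA ler_wpM2r ?mulr_ge0 // mulNr expRN lef_pV2 ?posrE ?expR_gt0 ?mulr_gt0 //.
  by have := expR_ge1Dx (u * D i j); lra.
(* From time [U] on, [M / u <= delta], so [h u >= E - delta = delta]; the summand 1 keeps [U]
   positive. *)
pose U := M / delta + 1.
have d0 : 0 < delta by rewrite divr_gt0.
have U0 : 0 < U by rewrite ltr_wpDl // divr_ge0 // ltW.
pose b := (2 : R) `^ a.
have b2 : b < 2.
  rewrite /b -[X in _ < X]powRr1 // /powR gt_eqF // ltr_expR ltr_pM2r //.
  by rewrite ln_gt0 // ltr1n.
have b0 : 0 < b by rewrite powR_gt0.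
pose B := 2 / b.
have B1 : 1 < B by rewrite ltr_pdivlMr // mul1r.
have Bb : B * b = 2 by rewrite divfK // gt_eqF.
pose tau := ln B / U.
have tau0 : 0 < tau by rewrite divr_gt0 // ln_gt0.
have tauU : expR (tau * U) = B.
  by rewrite /tau divfK ?gt_eqF // lnK // posrE; lra.
pose chi u := (1 - expR (- u * tau)) * (1 - B * expR (- u * tau)).
have hchi u : 0 <= u -> 0 <= h u - delta * chi u.
  move=> u0; have e0 := expR_gt0 (- u * tau).
  have e1 : expR (- u * tau) <= 1 by rewrite expR_le1 mulNr oppr_le0 mulr_ge0 // ltW.
  have BE : B * expR (- u * tau) = expR (tau * (U - u)).
    by rewrite -tauU -expRD; congr expR; ring.
  have [uU|Uu] := leP u U.
    have : chi u <= 0.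
      rewrite /chi mulr_ge0_le0 // ?subr_ge0 // subr_le0 BE -expR0 ler_expR.
      by rewrite (mulr_ge0 (ltW tau0)) // subr_ge0.
    by have := h0 u u0; nra.
  have chi1 : chi u <= 1.
    rewrite /chi; have : 0 < B * expR (- u * tau) by rewrite BE expR_gt0.
    have : B * expR (- u * tau) <= 1.
      by rewrite BE -expR0 ler_expR mulr_ge0_le0 ?(ltW tau0) // subr_le0 ltW.
    nra.
  have u0' : 0 < u by lra.
  have : M / u <= delta.
    rewrite ler_pdivrMr // mulrC -ler_pdivrMr //.
    by apply: le_trans (ltW Uu); rewrite /U lerDl.
  by have := hlarge u u0'; rewrite /delta in d0 *; nra.
(* The difference [h - delta * chi] as one exponential sum: off-diagonal pairs, then the two
   exponentials of the expanded [chi], with constant term [E - delta = delta]. Diagonal pairs get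
   weight 0 and a dummy time 1, since all times must be positive. *)
pose w (x : ('I_n.+1 * 'I_n.+1) + bool) := match x with
  | inl p => if p.2 != p.1 then eta p.1 * eta p.2 else 0
  | inr true => delta * (1 + B)
  | inr false => - (delta * B) end.
pose t (x : ('I_n.+1 * 'I_n.+1) + bool) := match x with
  | inl p => if p.2 != p.1 then D p.1 p.2 else 1
  | inr true => tau
  | inr false => 2 * tau end.
have sumw (f : R -> R) : \sum_x w x * f (t x) =
    \sum_i \sum_(j | j != i) f (D i j) * eta i * eta j
    + (delta * (1 + B) * f tau - delta * B * f (2 * tau)).
  rewrite big_sumType big_bool /= mulNr; congr (_ + _).
  rewrite -(pair_bigA _ (fun i j => w (inl (i, j)) * f (t (inl (i, j))))) /=.
  apply: eq_bigr => i _; rewrite [RHS]big_mkcond; apply: eq_bigr => j _.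
  by case: ifP => _; [ring|rewrite mul0r].
have t0 x : 0 < t x.
  case: x => [[i j]|[]] /=; [case: ifP => [ji|_] //| by [] |by rewrite mulr_gt0].
  by rewrite posD // eq_sym.
have := exp_sum_power_le0 a0 a1 t0 (ltW d0) (w := w).
rewrite (sumw (fun x => x `^ a)) => le0.
have {le0} : \sum_i \sum_(j | j != i) D i j `^ a * eta i * eta j
    + (delta * (1 + B) * tau `^ a - delta * B * (2 * tau) `^ a) <= 0.
  apply: le0.
    have -> : \sum_i w i = \sum_i w i * 1 by apply: eq_bigr => i _; rewrite mulr1.
    rewrite (sumw (fun=> 1)).
    (* At time 0 the kernel is constantly 1 and its form is the square of [\sum_i eta i = 0], so the
       off-diagonal part cancels [E]. *)
    have -> : \sum_i \sum_(j | j != i) 1 * eta i * eta j = - E.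
      have := hE 0; rewrite /h.
      rewrite (eq_qform (L := fun i j => 1 * 1)); last first.
        by move=> i j; rewrite oppr0 mul0r expR0 mulr1.
      rewrite (qform_rank_one (fun=> 1)) (eq_bigr eta) => [|i _]; last by rewrite mul1r.
      rewrite sum0 expr0n /= => e.
      suff -> : \sum_i \sum_(j | j != i) 1 * eta i * eta j
        = \sum_i \sum_(j | j != i) expR (- 0 * D i j) * eta i * eta j by lra.
      by apply: eq_bigr => i _; apply: eq_bigr => j _; rewrite oppr0 mul0r expR0.
    by rewrite /delta; field.
  move=> u u0; rewrite (sumw (fun x => expR (- u * x))).
  have := hchi u u0; rewrite hE /chi.
  have -> : expR (- u * (2 * tau)) = expR (- u * tau) * expR (- u * tau).
    by rewrite -expRD; congr expR; ring.
  rewrite /delta; set S := \sum_i _; move: (expR _) => e.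
  by congr (_ <= _); field.
rewrite qform_diag.
have -> : \sum_i D i i `^ a * eta i ^+ 2 = 0.
  by apply: big1 => i _; rewrite D0 powR0 ?mul0r ?gt_eqF.
rewrite add0r.
(* Since [B * b = 2], the two extra terms add up to [delta * tau ^ a * (B - 1) > 0], which forces
   the form to be negative. *)
rewrite powRM ?(ltW tau0) // -/b.
have : 0 < delta * tau `^ a * (B - 1) by rewrite !mulr_gt0 ?powR_gt0 // subr_gt0.
have -> : delta * B * (b * tau `^ a) = delta * tau `^ a * 2 by rewrite -Bb; ring.
by set S := \sum_i _; lra.
Qed.

End Schoenberg.

(** * Generalized roundness exponents as exponents of negative type *)

Section Roundness.
Variable R : realType.

Definition multiplicity (T : eqType) m (a : 'I_m -> T) (t : T) : R :=
  \sum_(i < m) (a i == t)%:R.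

Lemma sum_indicator (T : finType) (F : T -> R) t : \sum_i F i * (t == i)%:R = F t.
Proof.
rewrite (bigD1 t) //= eqxx mulr1 big1 ?addr0 // => i.
by rewrite eq_sym => /negbTE ->; rewrite mulr0.
Qed.

Lemma sum_multiplicity (T : finType) m (a : 'I_m -> T) (F : T -> R) :
  \sum_i F (a i) = \sum_t F t * multiplicity a t.
Proof.
rewrite /multiplicity; under [RHS]eq_bigr do rewrite mulr_sumr.
by rewrite exchange_big; apply: eq_bigr => i _ /=; rewrite sum_indicator.
Qed.

Definition bilform (T : finType) (K : T -> T -> R) (u v : T -> R) : R :=
  \sum_i \sum_j K i j * u i * v j.

Lemma sum2_multiplicity (T : finType) m (a b : 'I_m -> T) (K : T -> T -> R) :
  \sum_i \sum_j K (a i) (b j) = bilform K (multiplicity a) (multiplicity b).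
Proof.
under eq_bigr do rewrite (sum_multiplicity b (K _)).
rewrite (sum_multiplicity a (fun t => \sum_s K t s * multiplicity b s)).
apply: eq_bigr => t _; rewrite mulr_suml; apply: eq_bigr => s _.
by rewrite mulrAC.
Qed.

Lemma qformB (T : finType) (K : T -> T -> R) (u v : T -> R) :
  (forall i j, K i j = K j i) ->
  qform K (fun i => u i - v i) = bilform K u u + bilform K v v - bilform K u v *+ 2.
Proof.
move=> symK; have -> : bilform K u v *+ 2 = bilform K u v + bilform K v u.
  rewrite mulr2n; congr (_ + _); rewrite /bilform exchange_big.
  by apply: eq_bigr => i _; apply: eq_bigr => j _; rewrite symK mulrAC.
rewrite /qform /bilform -2!big_split -sumrB; apply: eq_bigr => i _ /=.
rewrite -2!big_split -sumrB; apply: eq_bigr => j _ /=.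
by ring.
Qed.

Lemma sum_lt_half m (f : 'I_m -> 'I_m -> R) :
  (forall i j, f i j = f j i) -> (forall i, f i i = 0) ->
  (\sum_(i < m) \sum_(j < m | (i < j)%N) f i j) *+ 2 = \sum_i \sum_j f i j.
Proof.
move=> symf f0; rewrite mulr2n.
have {2}-> : \sum_(i < m) \sum_(j < m | (i < j)%N) f i j
    = \sum_(i < m) \sum_(j < m | (j < i)%N) f i j.
  rewrite [RHS](exchange_big_dep xpredT) //=.
  by apply: eq_bigr => i _; apply: eq_bigr => j _; rewrite symf.
rewrite -big_split; apply: eq_bigr => i _ /=.
rewrite [RHS](bigID (fun j : 'I_m => (i < j)%N)) /=; congr (_ + _).
rewrite [LHS]big_mkcond [RHS]big_mkcond /=; apply: eq_bigr => j _.
by case: ltngtP => // /val_inj ->; rewrite f0.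
Qed.

(** Twice the left side minus the right side is the form at the difference of the multiplicities;
    the zero diagonal lets sums over [i < j] be doubled to full sums. *)
Lemma roundness_gap (T : finType) (K : T -> T -> R) m (a b : 'I_m -> T) :
  (forall i j, K i j = K j i) -> (forall i, K i i = 0) ->
  (\sum_(i < m) \sum_(j < m | (i < j)%N) (K (a i) (a j) + K (b i) (b j))
    <= \sum_i \sum_j K (a i) (b j)) =
  (qform K (fun t => multiplicity a t - multiplicity b t) <= 0).
Proof.
move=> symK K0; rewrite qformB // -!sum2_multiplicity.
have -> : \sum_i \sum_j K (a i) (a j) + \sum_i \sum_j K (b i) (b j)
    = (\sum_(i < m) \sum_(j < m | (i < j)%N) (K (a i) (a j) + K (b i) (b j))) *+ 2.
  rewrite sum_lt_half => [|i j|i]; last by rewrite !K0 addr0.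
    by rewrite -big_split; apply: eq_bigr => i _; rewrite -big_split.
  by rewrite symK [K (b i) _]symK.
by rewrite subr_le0 lerMn2r.
Qed.

Lemma sum_multiplicityB (T : finType) m (a b : 'I_m -> T) :
  \sum_t (multiplicity a t - multiplicity b t) = 0.
Proof.
have e (c : 'I_m -> T) : \sum_t multiplicity c t = m%:R.
  have := sum_multiplicity c (fun=> 1); rewrite sumr_const card_ord => ->.
  by apply: eq_bigr => t _; rewrite mul1r.
by rewrite sumrB !e subrr.
Qed.

Definition repeat_seq (T : finType) (alpha : T -> nat) : seq T :=
  flatten [seq nseq (alpha t) t | t <- enum T].

Lemma sum_repeat_seq (T : finType) (alpha : T -> nat) (F : T -> R) :
  \sum_(t <- repeat_seq alpha) F t = \sum_t F t *+ alpha t.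
Proof.
rewrite big_flatten big_map big_enum /=; apply: eq_bigr => t _.
by rewrite big_nseq iter_addr_0.
Qed.

Lemma size_repeat_seq (T : finType) (alpha : T -> nat) :
  size (repeat_seq alpha) = (\sum_t alpha t)%N.
Proof.
rewrite size_flatten /shape -map_comp sumnE big_map big_enum /=.
by apply: eq_bigr => t _; rewrite size_nseq.
Qed.

(** The length [m] is tied to the list only by an equation, so that two lists of equal size can be
    indexed by the same ['I_m]. *)
Lemma multiplicity_repeat_seq (T : finType) (alpha : T -> nat) x0 m t :
  m = size (repeat_seq alpha) ->
  multiplicity (fun i : 'I_m => nth x0 (repeat_seq alpha) i) t = (alpha t)%:R.
Proof.
move=> ->; rewrite /multiplicity.
have := sum_repeat_seq alpha (fun s => (s == t)%:R).
rewrite (big_nth x0) big_mkord => ->.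
rewrite -(sum_indicator (fun s => (alpha s)%:R) t); apply: eq_bigr => s _.
by rewrite -[LHS]mulr_natl eq_sym.
Qed.

Lemma floor_div_cvg (x : R) :
  ((Num.floor (N.+1%:R * x))%:~R / N.+1%:R @[N --> \oo] --> x)%classic.
Proof.
apply: (@squeeze_cvgr _ _ _ _ (fun N => x - N.+1%:R^-1) (fun=> x)).
- apply: nearW => N.
  have N0 : 0 < N.+1%:R :> R by rewrite ltr0n.
  have := floor_itv (N.+1%:R * x); rewrite intrD => /andP[h1 h2].
  apply/andP; split.
    by rewrite ler_pdivlMr // mulrBl mulVf ?gt_eqF //; move: h2; rewrite mulr1z; lra.
  by rewrite ler_pdivrMr // [x * _]mulrC.
- rewrite -[X in (_ --> X)%classic]subr0; apply: cvgB; first exact: cvg_cst.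
  exact: cvg_harmonic.
- exact: cvg_cst.
Qed.

(** Pairs of families give differences of natural weights, hence all integral weights of sum zero;
    scaling and a limit reach real weights. The condition [p != 0] makes the diagonal of [d ^ p]
    vanish, as [0 ^ 0 = 1]. *)
Lemma gr_exponentP n (d : 'I_n.+1 -> 'I_n.+1 -> R) (p : R) :
  (forall i j, d i j = d j i) -> (forall i, d i i = 0) -> p != 0 ->
  gr_exponent d p <-> neg_kernel (fun i j => d i j `^ p).
Proof.
move=> symd d0 p0; set K := fun i j => d i j `^ p.
have symK i j : K i j = K j i by rewrite /K symd.
have K0 i : K i i = 0 by rewrite /K d0 powR0.
split=> [gr|neg m a b]; last first.
  by rewrite (roundness_gap a b symK K0); apply: neg; apply: sum_multiplicityB.
have nat_case (alpha beta : 'I_n.+1 -> nat) : (\sum_t alpha t = \sum_t beta t)%N ->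
    qform K (fun t => (alpha t)%:R - (beta t)%:R) <= 0.
  move=> eqs; pose m := size (repeat_seq alpha).
  have eb : m = size (repeat_seq beta) by rewrite /m !size_repeat_seq.
  have := gr m (fun i => nth ord0 (repeat_seq alpha) i) (fun i => nth ord0 (repeat_seq beta) i).
  rewrite (roundness_gap _ _ symK K0); congr (_ <= _).
  by apply: eq_bigr => i _; apply: eq_bigr => j _; rewrite !multiplicity_repeat_seq.
have int_case (z : 'I_n.+1 -> int) : \sum_t z t = 0 -> qform K (fun t => (z t)%:~R) <= 0.
  move=> z0; pose alpha t := if 0 <= z t then `|z t|%N else 0%N.
  pose beta t := if 0 <= z t then 0%N else `|z t|%N.
  have zE t : z t = (alpha t)%:R - (beta t)%:R.
    by rewrite !natz /alpha /beta; case: (z t) => u /=; rewrite ?subr0 // NegzE sub0r.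
  have := nat_case alpha beta; have -> : (\sum_t alpha t = \sum_t beta t)%N.
    apply/eqP; rewrite -(eqr_nat int) !natr_sum -subr_eq0 -sumrB.
    by rewrite -(eq_bigr _ (fun t _ => zE t)) z0.
  move/(_ erefl); congr (_ <= _); apply: eq_bigr => i _; apply: eq_bigr => j _.
  by rewrite (zE i) (zE j) !rmorphB !rmorph_nat.
move=> eta eta0.
(* The rounding defect is charged to index [ord0] to restore sum zero; divided by [N.+1] it tends to
   [\sum_j eta j = 0]. *)
pose z N i : int := Num.floor (N.+1%:R * eta i)
   - (\sum_j Num.floor (N.+1%:R * eta j)) * (ord0 == i)%:R.
have cz i : ((z N i)%:~R / N.+1%:R @[N --> \oo] --> eta i)%classic.
  have -> : eta i = eta i - (\sum_j eta j) * (ord0 == i)%:R by rewrite eta0 mul0r subr0.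
  have -> : (fun N => (z N i)%:~R / N.+1%:R) = (fun N => (Num.floor (N.+1%:R * eta i))%:~R / N.+1%:R
     - (\sum_j (Num.floor (N.+1%:R * eta j))%:~R / N.+1%:R) * (ord0 == i)%:R) :> (nat -> R).
    apply/funext => N; rewrite /z intrB intrM mulrBl rmorph_sum /= -mulr_suml natz.
    by congr (_ - _); rewrite mulrAC; case: (_ == _).
  apply: cvgB; first exact: floor_div_cvg.
  apply: cvgMr_tmp; apply: cvg_big => [|j _]; first exact: add_continuous.
  exact: floor_div_cvg.
have cq : (qform K (fun i => (z N i)%:~R / N.+1%:R) @[N --> \oo] --> qform K eta)%classic.
  apply: (cvg_qform (K := fun=> K)) => [i j|i]; first exact: cvg_cst.
  exact: cz.
apply: (cvgr_to_le cq); apply: nearW => N.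
have -> : qform K (fun i => (z N i)%:~R / N.+1%:R) = qform K (fun i => (z N i)%:~R) / N.+1%:R ^+ 2.
  rewrite /qform mulr_suml; apply: eq_bigr => i _; rewrite mulr_suml.
  by apply: eq_bigr => j _; field; rewrite addrC natr1.
rewrite mulr_le0_ge0 ?invr_ge0 ?sqr_ge0 // int_case //.
rewrite sumrB -mulr_sumr (_ : \sum_(i < n.+1) (ord0 == i)%:R = 1) ?mulr1 ?subrr //.
rewrite (bigD1 ord0) //= big1 ?addr0 // => i; rewrite eq_sym => /negbTE -> //.
Qed.

End Roundness.

(** * The form of the cube metric and affine independence of the points *)

Section Cube.
Variable R : realType.

Definition barycentric_norm2 (T : finType) n (x : T -> 'rV[R]_n) (eta : T -> R) : R :=
  \sum_(c < n) (\sum_t eta t * x t 0 c) ^+ 2.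

Lemma barycentric_norm2_ge0 (T : finType) n (x : T -> 'rV[R]_n) eta :
  0 <= barycentric_norm2 x eta.
Proof. by apply: sumr_ge0 => c _; rewrite sqr_ge0. Qed.

Lemma barycentric_norm2_eq0 (T : finType) n (x : T -> 'rV[R]_n) eta :
  barycentric_norm2 x eta = 0 -> forall c, \sum_t eta t * x t 0 c = 0.
Proof.
move=> /psumr_eq0P h c; apply/eqP; rewrite -sqrf_eq0; apply/eqP.
by apply: h => // i _; rewrite sqr_ge0.
Qed.

(* On the cube |s - t| = (s - t)^2 coordinatewise, so the l1 metric is a squared Euclidean
   distance. *)
Lemma qform_l1dist (T : finType) n (x : T -> 'rV[R]_n) (eta : T -> R) :
  (forall t c, x t 0 c = 0 \/ x t 0 c = 1) -> \sum_t eta t = 0 ->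
  qform (fun s t => l1dist (x s) (x t)) eta = - barycentric_norm2 x eta *+ 2.
Proof.
move=> x01 eta0.
pose f c s t := x s 0 c ^+ 2 + x t 0 c ^+ 2 - x s 0 c * x t 0 c *+ 2.
rewrite (eq_qform (L := fun s t => \sum_(c < n) f c s t)); last first.
  move=> s t; apply: eq_bigr => c _; rewrite /f.
  by case: (x01 s c) (x01 t c) => -> [] ->;
    rewrite ?subrr ?subr0 ?sub0r ?normrN ?normr0 ?normr1; ring.
rewrite qform_sum /barycentric_norm2 mulNrn -sumrMnl -sumrN.
apply: eq_bigr => c _; rewrite /qform /f.
set y := \sum_t eta t * x t 0 c.
(* Both square terms carry a factor [\sum_t eta t = 0]; only the cross term survives. *)
transitivity (\sum_s ((\sum_t eta t) * (x s 0 c ^+ 2 * eta s)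
   + eta s * (\sum_t x t 0 c ^+ 2 * eta t) - (eta s * x s 0 c) * y *+ 2)).
  apply: eq_bigr => s _; rewrite /y mulr_suml 2!mulr_sumr -sumrMnl -big_split -sumrB /=.
  by apply: eq_bigr => t _; ring.
rewrite sumrB big_split /= -mulr_sumr -mulr_suml sumrMnl -mulr_suml eta0 !mul0r.
by rewrite add0r sub0r expr2.
Qed.

Variables (n k : nat) (x : 'I_k.+1 -> 'rV[R]_n).
Let V := \matrix_(i < k) (x (lift ord0 i) - x ord0).

(** A right inverse of [V] recovers the weights off [ord0] from the vector [\sum_i eta i * x i]; the
    weight at [ord0] is minus their sum, whence the factor 2. This is the uniform negativity that
    survives a small change of exponent. *)
Lemma row_free_barycentric_bound : row_free V ->
  exists2 C, 0 <= C & forall eta : 'I_k.+1 -> R, \sum_i eta i = 0 ->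
    \sum_i `|eta i| <= C * Num.sqrt (barycentric_norm2 x eta).
Proof.
move=> /mulmxVp VW; set W := pinvmx V in VW.
exists ((\sum_i \sum_c `|W c i|) *+ 2).
  by rewrite mulrn_wge0 //; apply: sumr_ge0 => i _; apply: sumr_ge0.
move=> eta eta0; rewrite big_ord_recl in eta0.
pose w : 'rV[R]_k := \row_i eta (lift ord0 i).
pose u : 'rV[R]_n := \row_c \sum_i eta i * x i 0 c.
have wV : w *m V = u.
  apply/rowP => c; rewrite !mxE big_ord_recl.
  have -> : eta ord0 = - \sum_i eta (lift ord0 i) by apply/eqP; rewrite -addr_eq0 eta0.
  rewrite mulNr mulr_suml addrC -sumrB; apply: eq_bigr => i _.
  by rewrite !mxE mulrBr.
have wE : w = u *m W by rewrite -wV -mulmxA VW mulmx1.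
set S := Num.sqrt _.
have uS c : `|u 0 c| <= S.
  rewrite -sqrtr_sqr ler_sqrt ?barycentric_norm2_ge0 // mxE /barycentric_norm2.
  by rewrite (bigD1 c) //= lerDl; apply: sumr_ge0 => i _; rewrite sqr_ge0.
have wS : \sum_i `|w 0 i| <= (\sum_i \sum_c `|W c i|) * S.
  rewrite mulr_suml; apply: ler_sum => i _; rewrite wE mxE mulr_suml.
  apply: le_trans (ler_norm_sum _ _ _) _; apply: ler_sum => c _.
  by rewrite normrM mulrC ler_wpM2l.
have e0 : `|eta ord0| <= \sum_i `|w 0 i|.
  have -> : eta ord0 = - \sum_i w 0 i.
    apply/eqP; rewrite -addr_eq0 -[X in _ == X]eta0; apply/eqP; congr (_ + _).
    by apply: eq_bigr => i _; rewrite mxE.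
  by rewrite normrN ler_norm_sum.
rewrite big_ord_recl (eq_bigr (fun i => `|w 0 i|)) => [|i _]; last by rewrite mxE.
by rewrite mulrnAl mulr2n; apply: lerD => //; apply: le_trans wS.
Qed.

(** A nonzero vector of the left kernel of [V] is completed at [ord0] by minus the sum of its
    entries. *)
Lemma not_row_free_affine_dependent : ~~ row_free V ->
  exists eta : 'I_k.+1 -> R,
    [/\ \sum_i eta i = 0, exists i, eta i != 0 & barycentric_norm2 x eta = 0].
Proof.
rewrite -kermx_eq0 => /rowV0Pn[v /sub_kermxP vV v0].
pose eta i := if unlift ord0 i is Some j then v 0 j else - \sum_j v 0 j.
have e1 j : eta (lift ord0 j) = v 0 j by rewrite /eta liftK.
have e0 : eta ord0 = - \sum_j v 0 j by rewrite /eta unlift_none.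
exists eta; split.
- by rewrite big_ord_recl e0 [X in _ + X](eq_bigr (v 0)) ?addNr.
- have /rV0Pn[j vj] := v0.
  by exists (lift ord0 j); rewrite e1.
- apply: big1 => c _; rewrite big_ord_recl e0 mulNr mulr_suml addrC -sumrB.
  have vVc : (v *m V) 0 c = 0 by rewrite vV mxE.
  rewrite [X in X ^+ 2](_ : _ = 0) ?expr0n // -[RHS]vVc mxE.
  by apply: eq_bigr => i _; rewrite e1 !mxE mulrBr.
Qed.

End Cube.

(** * Continuity in the exponent, and the criteria for roundness 1 and strict negative type *)

Lemma powR_cvg_exponent (R : realType) (d : R) : 0 <= d ->
  (d `^ (1 + N.+1%:R^-1) @[N --> \oo] --> d)%classic.
Proof.
move=> d0; rewrite -[X in (_ --> X)%classic](powRr1 d0).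
have [->|dn0] := eqVneq d 0.
  rewrite powR0 ?oner_neq0 //; apply: cvg_near_cst; apply: nearW => N.
  by rewrite powR0 // gt_eqF // ltr_wpDr.
rewrite /powR (negbTE dn0); apply: continuous_cvg; first exact: continuous_expR.
apply: cvgMr_tmp; rewrite -[X in (_ --> X)%classic]addr0; apply: cvgD; first exact: cvg_cst.
exact: cvg_harmonic.
Qed.

Theorem theorem4p3 (R : realType) (n k : nat) (x : 'I_k.+1 -> 'rV[R]_n) :
  (0 < n)%N ->
  (forall i j, x i 0 j = 0 \/ x i 0 j = 1) ->
  injective x ->
  let d := fun i j : 'I_k.+1 => l1dist (x i) (x j) in
  let V := \matrix_(i < k) (x (lift ord0 i) - x ord0) in
  (gen_roundness d = 1%:E <-> ~~ row_free V) /\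
  (strict_neg_type d 1 <-> row_free V).
Proof.
move=> _ x01 injx d V.
have d0 i j : 0 <= d i j by apply: sumr_ge0.
have symd i j : d i j = d j i by apply: eq_bigr => c _; rewrite distrC.
have dii i : d i i = 0 by apply: big1 => c _; rewrite subrr normr0.
have dpos i j : i != j -> 0 < d i j.
  move=> ij; rewrite lt0r d0 andbT; apply: contra ij => /eqP /psumr_eq0P dz.
  apply/eqP/injx/rowP => c; apply/eqP; rewrite -subr_eq0 -normr_eq0.
  by rewrite dz // => ? _.
have neg1 : neg_kernel (fun i j => d i j `^ 1).
  move=> eta eta0; rewrite (eq_qform (L := d)) => [|i j]; last by rewrite powRr1.
  by rewrite qform_l1dist // pmulrn_lle0 // oppr_le0 barycentric_norm2_ge0.
have gr1 : gr_exponent d 1 by apply/(gr_exponentP symd dii (oner_neq0 _)).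
have free_gt1 : row_free V -> exists2 p, 1 < p & gr_exponent d p.
  move=> /row_free_barycentric_bound[C C0 bound].
  (* As [E ^ 2 <= C ^ 2 * S], this choice gives [eps * E ^ 2 <= S], so the perturbation cannot
     outweigh the main term [- S *+ 2]. *)
  pose eps := (C ^+ 2 + 1)^-1.
  have eps0 : 0 < eps by rewrite invr_gt0 ltr_wpDl ?sqr_ge0.
  pose err p := \sum_i \sum_j `|d i j `^ p - d i j|.
  have : (err (1 + N.+1%:R^-1) @[N --> \oo] --> (0 : R))%classic.
    rewrite [X in (_ --> X)%classic](_ : _ = \sum_i \sum_j `|d i j - d i j|); last first.
      by rewrite big1 // => i _; rewrite big1 // => j _; rewrite subrr normr0.
    apply: cvg_big => [|i _]; first exact: add_continuous.
    apply: cvg_big => [|j _]; first exact: add_continuous.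
    apply: cvg_norm; apply: cvgB; last exact: cvg_cst.
    exact: powR_cvg_exponent.
  move=> /cvgrPdist_le/(_ eps eps0)[N _ /(_ N (leqnn N))].
  set p := 1 + _; rewrite sub0r normrN => /(le_trans (ler_norm _)) small.
  have p1 : 1 < p by rewrite ltrDl invr_gt0 ltr0n.
  exists p => //; apply/(gr_exponentP symd dii); first by rewrite gt_eqF // (lt_trans ltr01).
  move=> eta eta0; set S := barycentric_norm2 x eta.
  have S0 : 0 <= S by apply: barycentric_norm2_ge0.
  pose E := \sum_i `|eta i|.
  have etaE i : `|eta i| <= E by rewrite /E (bigD1 i) //= lerDl sumr_ge0.
  have E0 : 0 <= E by apply: sumr_ge0.
  have E2 : E ^+ 2 <= C ^+ 2 * S.
    rewrite -[S in _ * S]sqr_sqrtr // -exprMn.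
    by rewrite ler_pXn2r ?nnegrE ?mulr_ge0 ?sqrtr_ge0 ?bound.
  have -> : qform (fun i j => d i j `^ p) eta
      = qform d eta + qform (fun i j => d i j `^ p - d i j) eta.
    rewrite /qform -big_split; apply: eq_bigr => i _ /=.
    by rewrite -big_split; apply: eq_bigr => j _ /=; ring.
  rewrite qform_l1dist //.
  have : qform (fun i j => d i j `^ p - d i j) eta <= err p * E ^+ 2.
    rewrite mulr_suml; apply: ler_sum => i _; rewrite mulr_suml; apply: ler_sum => j _.
    rewrite (le_trans (ler_norm _)) // !normrM -mulrA ler_wpM2l // expr2.
    by apply: ler_pM.
  have : err p * E ^+ 2 <= eps * E ^+ 2 by rewrite ler_wpM2r ?sqr_ge0.
  have : eps * E ^+ 2 <= S.
    rewrite mulrC ler_pdivrMr; last by rewrite ltr_wpDl ?sqr_ge0.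
    by rewrite mulrDr mulr1 mulrC; lra.
  rewrite -/S; lra.
have dep_le1 p : ~~ row_free V -> gr_exponent d p -> p <= 1.
  move=> /not_row_free_affine_dependent[eta [eta0 nz S0]] grp.
  rewrite leNgt; apply/negP => p1; have p0 : 0 < p by rewrite (lt_trans ltr01).
  have pn0 : p != 0 by rewrite gt_eqF.
  have /(gr_exponentP symd dii pn0) negp := grp.
  have : qform (fun i j => (d i j `^ p) `^ p^-1) eta < 0.
    apply: neg_kernel_power_lt0 => //.
    - by move=> i j; rewrite symd.
    - by move=> i; rewrite dii powR0.
    - by move=> i j ij; rewrite powR_gt0 // dpos.
    - by rewrite invr_gt0.
    - by rewrite invf_lt1.
  rewrite (eq_qform (L := d)) => [|i j]; last by rewrite -powRrM divff // powRr1.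
  by rewrite qform_l1dist // S0 oppr0 mul0rn ltxx.
split; split.
- move=> e; apply/negP => /free_gt1[p p1 grp].
  have : (p%:E <= gen_roundness d)%E.
    by apply: ereal_sup_ubound; exists p => //; split=> //; rewrite (le_trans ler01) ?ltW.
  by rewrite e lee_fin leNgt p1.
- move=> nfree; apply/eqP; rewrite eq_le; apply/andP; split.
    by apply: ge_ereal_sup => _ [p [_ grp] <-]; rewrite lee_fin dep_le1.
  by apply: ereal_sup_ubound; exists 1.
- move=> [_ strict]; apply: contraT => /not_row_free_affine_dependent[eta [eta0 [i nz] S0]].
  (* Strict negative type only tests families of at least two points; with one point, sum zero would
     force [eta = 0]. *)
  have k0 : (1 < k.+1)%N.
    rewrite ltnS lt0n; apply/negP => /eqP k0; move: eta0; rewrite (bigD1 i) //= big1 ?addr0.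
      by move/eqP; rewrite (negbTE nz).
    move=> j /eqP ji; exfalso; apply: ji; apply: ord_inj.
    have val0 (t : 'I_k.+1) : t = 0%N :> nat.
      by apply/eqP; rewrite -leqn0 -[X in (_ <= X)%N]k0 -ltnS.
    by rewrite !val0.
  have := strict _ id k0 (fun _ _ => id) eta eta0 (ex_intro _ i nz).
  rewrite -/(qform (fun i j => d i j `^ 1) eta) (eq_qform (L := d)); last first.
    by move=> i' j; rewrite powRr1.
  by rewrite qform_l1dist // S0 oppr0 mul0rn ltxx.
- move=> free.
  have qE m (y : 'I_m -> 'I_k.+1) eta : \sum_i eta i = 0 ->
      \sum_(i < m) \sum_(j < m) (d (y i) (y j)) `^ 1 * eta i * eta j
      = - barycentric_norm2 (x \o y) eta *+ 2.
    move=> eta0; rewrite -(qform_l1dist (fun t => x01 (y t)) eta0) /qform; apply: eq_bigr => i _.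
    by apply: eq_bigr => j _; rewrite powRr1.
  split=> [m y _ _ eta eta0|m y _ injy eta eta0 [i0 nz]].
    by rewrite qE // pmulrn_lle0 // oppr_le0 barycentric_norm2_ge0.
  rewrite qE // pmulrn_llt0 // oppr_lt0 lt0r barycentric_norm2_ge0 andbT.
  apply: contra nz => /eqP /barycentric_norm2_eq0 bz.
  have [C C0 bound] := row_free_barycentric_bound free.
  (* Pushing the weights forward along [y] reduces a subfamily to the full set; injectivity of [y]
     lets [eta] be read off [eta']. *)
  pose eta' t := \sum_(i | y i == t) eta i.
  have push (F : 'I_k.+1 -> R) : \sum_t eta' t * F t = \sum_i eta i * F (y i).
    rewrite (partition_big y xpredT) //=; apply: eq_bigr => t _.
    by rewrite mulr_suml; apply: eq_bigr => i /eqP ->.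
  have eta'0 : \sum_t eta' t = 0.
    have := push (fun=> 1); under eq_bigr do rewrite mulr1.
    by under [RHS]eq_bigr do rewrite mulr1; rewrite eta0.
  have := bound eta' eta'0.
  have -> : barycentric_norm2 x eta' = 0.
    apply: big1 => c _; rewrite (push (fun t => x t 0 c)).
    by rewrite [X in X ^+ 2]bz expr0n.
  rewrite sqrtr0 mulr0 => le0.
  have /psumr_eq0P/(_ (y i0) isT) : \sum_t `|eta' t| = 0.
    by apply/eqP; rewrite eq_le le0 sumr_ge0.
  have -> : eta' (y i0) = eta i0.
    rewrite /eta' (bigD1 i0) //= big1 ?addr0 // => i /andP[/eqP/injy ->].
    by rewrite eqxx.
  by move=> h; rewrite -normr_eq0 h // => t _.
Qed.
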